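(* Let $X, X_1,\ldots, X_n$ be iid random matrices with values in $\mathcal{S}_d$ such that $0 \preceq X \preceq I$ almost surely. Let $0 \leq m \leq a \leq 1$ be constants such that $\mathbb{E} X \preceq m I$, and let $A\in\mathcal{S}_d$ be a deterministic matrix with $A \succeq a I$. Then $$\mathbb{P}\left(\sum_{i=1}^n X_i \succeq n A\right) \leq \exp (-n D(a \| m)),$$ where $D(x \| y)=x(\log x-\log y)+(1-x)(\log (1-x)-\log (1-y))$.
   Context: $\mathcal{S}_d$ denotes the set of $d\times d$ real symmetric matrices and $I$ is the identity matrix. The Loewner order: for $A,B\in\mathcal{S}_d$, $A \preceq B$ (equivalently $B\succeq A$) means $B-A$ is positive semidefinite. Iid means independent and identically distributed. The usual conventions for relative entropy are used at the endpoints: a term of $D$ whose prefactor ($x$ or $1-x$) is $0$ equals $0$, $D(x\|0)=+\infty$ for $x>0$, and $\exp(-\infty)=0$. *)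

(* Defs.v *)
From mathcomp Require Import all_boot all_order all_algebra.
From mathcomp Require Import all_classical all_reals all_analysis.

Set Implicit Arguments.
Unset Strict Implicit.
Unset Printing Implicit Defensive.

Import Order.TTheory GRing.Theory Num.Theory.
Import numFieldNormedType.Exports.

Local Open Scope classical_set_scope.
Local Open Scope ring_scope.

Definition psdmx (R : realType) (d : nat) (M : 'M[R]_d) : Prop :=
  M \is symmetricmx /\ forall v : 'cV[R]_d, 0 <= (v^T *m M *m v) 0 0.

Definition loewner (R : realType) (d : nat) (A B : 'M[R]_d) : Prop :=
  psdmx (B - A).

Notation borel_mx R d := (g_sigma_algebraType (@open 'M[R]_d)).

Definition expectation_mx (disp : measure_display) (T : measurableType disp)
    (R : realType) (P : probability T R) (d : nat) (X : T -> 'M[R]_d) :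
    'M[R]_d :=
  \matrix_(i, j) fine ('E_P[fun w => X w i j])%E.

Section iid.
Context (disp disp' : measure_display) (T : measurableType disp)
  (T' : measurableType disp') (R : realType) (P : probability T R).

Definition mutually_independent (I : finType) (X : I -> {RV P >-> T'}) : Prop :=
  forall (J : {set I}) (B : I -> set T'), (forall i, measurable (B i)) ->
    (P (\bigcap_(i in [set` J]) (X i @^-1` B i)) =
     \prod_(i in J) P (X i @^-1` B i))%E.

Definition identically_distributed (I : finType) (X : I -> {RV P >-> T'}) :
    Prop :=
  forall (i j : I) (B : set T'), measurable B ->
    distribution P (X i) B = distribution P (X j) B.

Definition iid (I : finType) (X : I -> {RV P >-> T'}) : Prop :=
  mutually_independent X /\ identically_distributed X.

End iid.

(* In \bar R, lne 0 = -oo and 0 * z = 0 for every z, including infinite z.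
   Hence a term with prefactor 0 vanishes, and D(x || 0) = +oo for x > 0. *)
Definition rel_entropy (R : realType) (x y : R) : \bar R :=
  (x%:E * (lne x%:E - lne y%:E) +
   (1 - x)%:E * (lne (1 - x)%:E - lne (1 - y)%:E))%E.

(* Main.v *)
Require Import Defs.
From mathcomp Require Import all_boot all_order all_algebra.
From mathcomp Require Import all_classical all_reals all_analysis.
From mathcomp Require Import measurable_realfun ring.

(** If [\sum_i X_i - n A] is positive semidefinite then its top-left entry is
    nonnegative, so [\sum_i Y_i >= n a] for the scalars [Y_i], the top-left
    entries of the [X_i], which are iid, a.s. in [0, 1], with mean at most
    [m]. It remains to prove the scalar Chernoff bound. To get [E (\prod_i
    expR (t Y_i))] out of independence of events alone, [0, 1] is cut into [N]
    cells of length [1/N], the probability is bounded by a finite sum over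
    tuples of cells, which factors, and [N] goes to infinity. Then [t] is
    optimised; the cases [m = 0 < a] and [m < a = 1] correspond to [t] going
    to infinity. *)

Set Implicit Arguments.
Unset Strict Implicit.
Unset Printing Implicit Defensive.

Import Order.TTheory GRing.Theory Num.Theory.
Import numFieldNormedType.Exports.

Local Open Scope classical_set_scope.
Local Open Scope ring_scope.

(** * Scalar Chernoff bound by partitioning the unit interval *)

(** Convexity of [expR]: [t * y] is the average of [t] and [0] with weights [y] and [1 - y]. *)
Lemma expR_le_chord (R : realType) (t y : R) :
  0 <= y -> y <= 1 -> expR (t * y) <= 1 + (expR t - 1) * y.
Proof.
move=> y0 y1; have := convex_expR (Itv01 y0 y1) (t : R^o) 0.
rewrite !convRE /= expR0 mulr0 addr0 mulr1 [y * t]mulrC => /le_trans; apply.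
rewrite [leRHS](_ : _ = y * expR t + (1 - y)); last by ring.
exact: lexx.
Qed.

Lemma measure_bigsetU_le (d : measure_display) (T : measurableType d)
    (R : realType) (mu : {measure set T -> \bar R}) (I : Type) (s : seq I)
    (Q : pred I) (F : I -> set T) :
  (forall i, measurable (F i)) ->
  (mu (\big[setU/set0]_(i <- s | Q i) F i) <= \sum_(i <- s | Q i) mu (F i))%E.
Proof.
move=> mF; elim: s => [|i s IH]; first by rewrite !big_nil measure0.
rewrite !big_cons; case: ifP => // _.
have mS : measurable (\big[setU/set0]_(j <- s | Q j) F j).
  by apply: bigsetU_measurable => j _.
by apply: (le_trans (measureU2 _ (mF i) mS)); exact: leeD2l.
Qed.

Lemma continuous_measurable_mx (R : realType) (d : nat) (f : 'M[R]_d -> R) :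
  continuous f -> measurable_fun [set: borel_mx R d] (f : borel_mx R d -> R).
Proof.
move=> /continuousP cf; apply: (measurability _ (RGenOpens.measurableE R)).
move=> _ [_ [a [b ->] <-]]; rewrite setTI.
by apply: sub_sigma_algebra; apply/cf/interval_open.
Qed.

(* The half-open interval from (k - 1) / N, excluded, to k / N, included. *)
Definition cell (R : realType) (N k : nat) : set R :=
  [set y | Num.ceil (N%:R * y) = k%:Z].

Lemma measurable_cell (R : realType) (N k : nat) : measurable (@cell R N k).
Proof.
have -> : @cell R N k =
    [set y | N%:R * y <= k%:R] `&` ~` [set y | N%:R * y <= k%:R - 1].
  apply/seteqP; split => y /=; rewrite /cell /=.
    move=> e; split; first by rewrite -[k%:R]/(k%:Z%:~R) -ceil_le_int e.
    apply/negP; rewrite -[k%:R]/(k%:Z%:~R) -[1]/(1%:~R) -intrB -ceil_le_int e.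
    by rewrite -ltNge ltrBlDr ltrDl.
  move=> [yk /negP]; rewrite -[k%:R]/(k%:Z%:~R) -[1]/(1%:~R) -intrB.
  rewrite -ceil_le_int -ltNge ltrBlDr ltzD1 => yk'.
  by apply/eqP; rewrite eq_le yk' andbT ceil_le_int.
have mN c : measurable [set y : R | N%:R * y <= c].
  by rewrite -[X in measurable X]setTI; apply: measurable_fun_le.
by apply: measurableI => //; apply: measurableC.
Qed.

(** The left side is the integral of the step function equal to [expR (t * (k / N))] on the [k]-th
    cell. The chord bound at [k / N], which exceeds [Y] by less than [1 / N], dominates it by an
    affine function of [|Y|]; the term [N%:R^-1] is the rounding error. With [|Y|] the dominating
    function is nonnegative everywhere, not only almost surely. *)
Lemma cell_moment (R : realType) (d : measure_display) (T : measurableType d)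
    (P : probability T R) (Y : T -> R) (m t : R) (N : nat) :
  measurable_fun setT Y -> (\int[P]_w `|Y w|%:E <= m%:E)%E ->
  0 <= t -> (0 < N)%N ->
  \sum_(k < N.+1) fine (P (Y @^-1` cell N k)) * expR (t * (k%:R / N%:R)) <=
  1 + (expR t - 1) * (m + N%:R^-1).
Proof.
move=> mY EY t0 N0.
have N0' : 0 < N%:R :> R by rewrite ltr0n.
have b0 : 0 <= expR t - 1 by rewrite subr_ge0 -expR0 ler_expR.
have mc k : measurable (Y @^-1` cell N k).
  by rewrite -[X in measurable X]setTI; apply: mY => //; exact: measurable_cell.
pose f (k : 'I_N.+1) w : \bar R :=
  ((expR (t * (k%:R / N%:R)))%:E * (\1_(Y @^-1` cell N k) w)%:E)%E.
have mf k : measurable_fun setT (f k).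
  by apply: emeasurable_funM => //; apply/measurable_EFinP/measurable_indic.
have f0 k w : (0 <= f k w)%E.
  by rewrite /f mule_ge0// lee_fin ?expR_ge0.
rewrite -lee_fin -sumEFin.
have -> : (\sum_(k < N.+1) (fine (P (Y @^-1` cell N k)) *
    expR (t * (k%:R / N%:R)))%:E = \int[P]_w \sum_(k < N.+1) f k w)%E.
  rewrite ge0_integral_sum//; apply: eq_bigr => k _.
  rewrite /f ge0_integralZl//; last exact/measurable_EFinP/measurable_indic.
  by rewrite integral_indic// setIT EFinM muleC fineK// fin_num_measure.
pose g w : \bar R := ((expR t - 1)%:E * (`|Y w|%:E))%E.
have mg : measurable_fun setT g.
  apply: emeasurable_funM => //; apply/measurable_EFinP.
  exact: measurableT_comp.
have g0 w : (0 <= g w)%E by rewrite /g mule_ge0// lee_fin.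
pose c : R := 1 + (expR t - 1) * N%:R^-1.
have c0 : 0 <= c by rewrite /c addr_ge0// mulr_ge0// invr_ge0 ltW.
apply: (@le_trans _ _ (\int[P]_w (c%:E + g w))%E).
  apply: ge0_le_integral => //.
  - by move=> w _; apply: sume_ge0.
  - exact: emeasurable_sum.
  - exact: emeasurable_funD.
  move=> w _.
  (* Outside all cells the sum is 0; inside one, only its own term survives, because the ceiling
     takes a single value. *)
  have [[k yk]|no] := pselect (exists k : 'I_N.+1, cell N k (Y w)); last first.
    rewrite big1 ?adde_ge0// => k _; rewrite /f indicE memNset ?mule0//.
    by move=> yk; apply: no; exists k.
  rewrite (bigD1 k)//= big1 ?adde0; last first.
    move=> j jk; rewrite /f indicE memNset ?mule0// => yj.
    move: yk yj; rewrite /cell /= => -> [] kj; move/eqP: jk; apply.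
    exact: ord_inj.
  rewrite /f indicE mem_set// mule1 /g /c -EFinM -EFinD lee_fin.
  have kN : k%:R / N%:R <= `|Y w| + N%:R^-1.
    rewrite ler_pdivrMr// mulrDl mulVf ?gt_eqF//.
    have /andP[+ _] := ceil_itv (N%:R * Y w); rewrite yk intrB ltrBlDr => /ltW.
    by move=> /le_trans; apply; rewrite lerD2r mulrC ler_wpM2r ?ler_norm.
  apply: (le_trans (expR_le_chord _ _ _)).
  - by rewrite divr_ge0// ltW.
  - by rewrite ler_pdivrMr// mul1r ler_nat -ltnS.
  by rewrite -addrA lerD2l -mulrDr [X in _ <= _ * X]addrC ler_wpM2l.
have mnY : measurable_fun setT (fun w => `|Y w|%:E).
  by apply/measurable_EFinP; exact: measurableT_comp.
rewrite ge0_integralD// integral_cst// ge0_integralZl//.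
rewrite [X in (c%:E * X)%E](_ : _ = 1%E); last exact: probability_setT.
rewrite mule1.
apply: (@le_trans _ _ (c%:E + (expR t - 1)%:E * m%:E)%E).
  by rewrite leeD2l// lee_wpmul2l// lee_fin.
by rewrite -EFinM -EFinD lee_fin /c -addrA -mulrDr [X in _ * X]addrC.
Qed.

(** The value [y = 0] lies in the cell of index 0, so the [N] cells inside the unit interval need
    one more index: hence [N.+1]. *)
Lemma cell_cover (R : realType) (N : nat) (y : R) :
  0 <= y <= 1 -> exists k : 'I_N.+1, cell N k y.
Proof.
move=> /andP[y0 y1].
have c0 : 0 <= Num.ceil (N%:R * y).
  by rewrite ceil_ge0 (lt_le_trans (ltrN10 _))// mulr_ge0.
have cN : (`|Num.ceil (N%:R * y)| < N.+1)%N.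
  rewrite ltnS -lez_nat gez0_abs// ceil_le_int -[leRHS]mulr1.
  by rewrite ler_wpM2l.
by exists (Ordinal cN); rewrite /cell /= gez0_abs.
Qed.

(** A discrete form of Markov's inequality for [expR (t * (\sum_i Ys i - n * a))]: a union bound
    over tuples of cells, whose probabilities factor by the product hypothesis, followed by
    exponential weights that turn the sum into an [n]-th power of the sum bounded in
    [cell_moment]. *)
Lemma chernoff_cells (R : realType) (d : measure_display)
    (T : measurableType d) (P : probability T R) (n : nat)
    (Y : T -> R) (Ys : 'I_n -> T -> R) (a m t : R) (N : nat) :
  measurable_fun setT Y -> (forall i, measurable_fun setT (Ys i)) ->
  (forall B : 'I_n -> set R, (forall i, measurable (B i)) ->
    P (\bigcap_(i in setT) (Ys i @^-1` B i)) =
    (\prod_(i < n) P (Y @^-1` B i))%E) ->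
  {ae P, forall w, 0 <= Y w <= 1} ->
  (\int[P]_w `|Y w|%:E <= m%:E)%E -> 0 <= t -> (0 < N)%N ->
  (P [set w | (n%:R * a <= \sum_(i < n) Ys i w)%R] <=
   ((expR (- (t * a)) * (1 + (expR t - 1) * (m + N%:R^-1))) ^+ n)%:E)%E.
Proof.
move=> mY mYs iidYs Y01 EY t0 N0.
have N0' : 0 < N%:R :> R by rewrite ltr0n.
have mYB B : measurable B -> measurable (Y @^-1` B).
  by move=> mB; rewrite -[X in measurable X]setTI; exact: mY.
have mYsB i B : measurable B -> measurable (Ys i @^-1` B).
  by move=> mB; rewrite -[X in measurable X]setTI; exact: mYs.
have mI (B : 'I_n -> set R) : (forall i, measurable (B i)) ->
    measurable (\bigcap_(i in setT) (Ys i @^-1` B i)).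
  by move=> mB; apply: fin_bigcap_measurable => // i _; exact: mYsB.
set A := [set w | _].
have mA : measurable A.
  rewrite -[X in measurable X]setTI; apply: measurable_fun_le => //.
  exact: measurable_sum.
(* All the [Ys i] lie in [[0, 1]] on [G]. The product formula transfers the almost sure bound from
   [Y] to them, so intersecting with [G] costs no probability. *)
pose G := \bigcap_(i in [set: 'I_n]) (Ys i @^-1` `[0, 1]%classic).
have mG : measurable G by exact: mI.
have PG : P G = 1%E.
  rewrite iidYs// big1// => i _.
  suff PC : P (~` (Y @^-1` `[0, 1]%classic)) = 0%E.
    have m01 := mYB _ (measurable_itv `[0, 1]).
    by have := probability_setC P (measurableC m01); rewrite setCK PC sube0.
  apply/negligibleP; first exact/measurableC/mYB.
  by apply: negligibleS Y01 => w /=; rewrite in_itv.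
have PAG : (P A <= P (A `&` G))%E.
  have mAG : measurable (A `&` G) by exact: measurableI.
  have mGC : measurable (~` G) by exact: measurableC.
  have PGC : P (~` G) = 0%E by rewrite probability_setC// PG subee.
  rewrite -[leRHS]adde0 -[X in (_ + X)%E]PGC.
  apply: le_trans (measureU2 P mAG mGC).
  apply: le_measure; rewrite ?inE//; first exact: measurableU.
  by move=> w Aw; have [Gw|Gw] := pselect (G w); [left|right].
pose p k := fine (P (Y @^-1` cell N k)).
have p0 k : 0 <= p k by rewrite fine_ge0.
pose E (f : {ffun 'I_n -> 'I_N.+1}) :=
  \bigcap_(i in [set: 'I_n]) (Ys i @^-1` cell N (f i)).
have mE f : measurable (E f) by apply: mI => i; exact: measurable_cell.
have PE f : P (E f) = (\prod_(i < n) p (f i))%:E.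
  rewrite iidYs; last by move=> i; exact: measurable_cell.
  rewrite -prodEFin; apply: eq_bigr => i _.
  by rewrite fineK// fin_num_measure//; apply: mYB; exact: measurable_cell.
pose S (f : {ffun 'I_n -> 'I_N.+1}) :=
  n%:R * a <= \sum_(i < n) ((f i)%:R / N%:R).
(* Replacing each value by the upper end of its cell only increases the sum, so the tuple of cells
   met by a point of [A] satisfies [S]. *)
have AGE : A `&` G `<=` \big[setU/set0]_(f | S f) E f.
  move=> w [Aw Gw].
  have Yw i : 0 <= Ys i w <= 1 by have := Gw i I; rewrite /= in_itv.
  have [f cf] : {f : {ffun 'I_n -> 'I_N.+1} &
      forall i, cell N (f i) (Ys i w)}.
    exists [ffun i => projT1 (cid (cell_cover N (Yw i)))] => i.
    by rewrite ffunE; case: cid.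
  rewrite -bigcup_seq_cond; exists f => /=; last by move=> i _; exact: cf.
  rewrite mem_index_enum /S (le_trans Aw)// ler_sum// => i _.
  rewrite ler_pdivlMr// mulrC; have := cf i; rewrite /cell /= => cfi.
  by have /andP[_] := ceil_itv (N%:R * Ys i w); rewrite cfi.
apply: (le_trans PAG); apply: (@le_trans _ _ (\sum_(f | S f) P (E f))%E).
  apply: le_trans (measure_bigsetU_le P _ _ mE).
  apply: le_measure; rewrite ?inE//; first exact: measurableI.
  by apply: bigsetU_measurable => f _.
rewrite (eq_bigr _ (fun f _ => PE f)) sumEFin lee_fin.
(* For [f] in [S] the inserted weight [expR (t * (\sum_i f i / N - n * a))], split over the [n]
   factors, is at least 1; the other tuples add nonnegative terms. *)
apply: (@le_trans _ _ (\sum_(f : {ffun 'I_n -> 'I_N.+1})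
    \prod_(i < n) (expR (- (t * a)) *
      (p (f i) * expR (t * ((f i)%:R / N%:R)))))).
  rewrite [leRHS](bigID S)/= -[leLHS]addr0 lerD//; last first.
    apply: sumr_ge0 => f _; apply: prodr_ge0 => i _.
    by rewrite !mulr_ge0 ?expR_ge0.
  apply: ler_sum => f Sf; rewrite -[leLHS]mulr1.
  under [leRHS]eq_bigr do rewrite mulrCA -expRD.
  rewrite big_split/= -expR_sum ler_wpM2l ?prodr_ge0//.
  rewrite -[leLHS]expR0 ler_expR big_split/= sumr_const card_ord -mulr_sumr.
  by rewrite -[X in X + _]mulr_natl mulrN mulrCA addrC subr_ge0 ler_wpM2l.
(* Distributivity: a sum over all tuples of products is a product of sums. *)
rewrite -(bigA_distr_bigA (fun (i : 'I_n) (k : 'I_N.+1) =>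
  expR (- (t * a)) * (p k * expR (t * (k%:R / N%:R))))).
rewrite prodr_const card_ord -mulr_sumr.
have q0 : 0 <= \sum_(k < N.+1) p k * expR (t * (k%:R / N%:R)).
  by apply: sumr_ge0 => k _; rewrite mulr_ge0 ?expR_ge0.
have qle := cell_moment mY EY t0 N0.
rewrite lerXn2r ?nnegrE ?ler_wpM2l ?mulr_ge0 ?expR_ge0//.
exact: le_trans qle.
Qed.

Lemma chernoff_mgf (R : realType) (d : measure_display)
    (T : measurableType d) (P : probability T R) (n : nat)
    (Y : T -> R) (Ys : 'I_n -> T -> R) (a m t : R) :
  measurable_fun setT Y -> (forall i, measurable_fun setT (Ys i)) ->
  (forall B : 'I_n -> set R, (forall i, measurable (B i)) ->
    P (\bigcap_(i in setT) (Ys i @^-1` B i)) =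
    (\prod_(i < n) P (Y @^-1` B i))%E) ->
  {ae P, forall w, 0 <= Y w <= 1} ->
  (\int[P]_w `|Y w|%:E <= m%:E)%E -> 0 <= t ->
  (P [set w | (n%:R * a <= \sum_(i < n) Ys i w)%R] <=
   ((expR (- (t * a)) * (1 + (expR t - 1) * m)) ^+ n)%:E)%E.
Proof.
move=> mY mYs iidYs Y01 EY t0.
have mA : measurable [set w | n%:R * a <= \sum_(i < n) Ys i w].
  rewrite -[X in measurable X]setTI; apply: measurable_fun_le => //.
  exact: measurable_sum.
have h N := chernoff_cells a mY mYs iidYs Y01 EY t0 (ltn0Sn N).
rewrite -[leLHS]fineK ?fin_num_measure// lee_fin.
(* [harmonic N] is the inverse of [N.+1], the cell length used in [h]. *)
pose u N : R := (expR (- (t * a)) * (1 + (expR t - 1) * (m + harmonic N))) ^+ n.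
apply: (@cvgr_to_ge _ \oo _ _ u).
  rewrite /u; apply: (@cvg_comp _ _ _ _ (fun y : R => y ^+ n)); last first.
    exact: exprn_continuous.
  apply: cvgM; first exact: cvg_cst.
  apply: cvgD; first exact: cvg_cst.
  apply: cvgM; first exact: cvg_cst.
  rewrite -[X in _ --> X]addr0.
  by apply: cvgD; [exact: cvg_cst|exact: cvg_harmonic].
by apply: nearW => N; rewrite -lee_fin fineK ?fin_num_measure// h.
Qed.

(** * Relative entropy and the choice of [t] *)

Lemma rel_entropy_interior (R : realType) (a m : R) :
  0 < a -> a < 1 -> 0 < m -> m < 1 ->
  rel_entropy a m =
  (a * (ln a - ln m) + (1 - a) * (ln (1 - a) - ln (1 - m)))%:E.
Proof. by move=> *; rewrite /rel_entropy !lne_EFin ?subr_gt0. Qed.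

Lemma rel_entropy_refl (R : realType) (a : R) :
  0 <= a <= 1 -> rel_entropy a a = 0%E.
Proof.
move=> /andP[]; rewrite le_eqVlt => /predU1P[<- _|a0].
  by rewrite /rel_entropy mul0e subr0 lne1 subee// mule0 adde0.
rewrite le_eqVlt => /predU1P[->|a1].
  by rewrite /rel_entropy lne1 subrr mul0e subee// mule0 adde0.
by rewrite rel_entropy_interior// !subrr !mulr0 addr0.
Qed.

Lemma rel_entropy0r (R : realType) (a : R) :
  0 < a <= 1 -> rel_entropy a 0 = +oo%E.
Proof.
have lne0 : lne 0%:E = -oo%E :> \bar R by rewrite /= lexx.
move=> /andP[a0]; rewrite /rel_entropy subr0 lne1 lne0 lne_EFin//.
rewrite le_eqVlt => /predU1P[->|a1].
  by rewrite subrr mul0e adde0 mul1e.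
by rewrite lne_EFin ?subr_gt0//= gt0_muley ?lte_fin.
Qed.

Lemma rel_entropy1l (R : realType) (m : R) :
  0 < m -> rel_entropy 1 m = (- ln m)%:E.
Proof.
move=> m0; rewrite /rel_entropy subrr mul0e adde0 mul1e lne1 lne_EFin//.
by rewrite sub0e.
Qed.

(** This [t] is the critical point of the left side in [t]: setting the logarithmic derivative to 0
    gives [expR t = a (1 - m) / (m (1 - a))], and the second factor becomes [(1 - m) / (1 - a)]. *)
Lemma expR_tilt (R : realType) (a m : R) :
  0 < a -> a < 1 -> 0 < m -> m < 1 ->
  let t := ln (a * (1 - m) / (m * (1 - a))) in
  expR (- (t * a)) * (1 + (expR t - 1) * m) =
  expR (- (a * (ln a - ln m) + (1 - a) * (ln (1 - a) - ln (1 - m)))).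
Proof.
move=> a0 a1 m0 m1 t.
have a1' : 0 < 1 - a by rewrite subr_gt0.
have m1' : 0 < 1 - m by rewrite subr_gt0.
have tE : t = ln a + ln (1 - m) - ln m - ln (1 - a).
  by rewrite /t ln_div ?posrE ?mulr_gt0// !lnM ?posrE// opprD addrA.
have -> : 1 + (expR t - 1) * m = expR (ln (1 - m) - ln (1 - a)).
  rewrite expRD expRN !lnK ?posrE ?divr_gt0 ?mulr_gt0//.
  by field; rewrite !gt_eqF.
by rewrite -expRD tE; congr expR; ring.
Qed.

Lemma le_expeR_rel_entropy (R : realType) (n : nat) (a m x : R) :
  0 <= m -> m <= a -> a <= 1 -> x <= 1 ->
  (forall t, 0 <= t ->
     x <= (expR (- (t * a)) * (1 + (expR t - 1) * m)) ^+ n) ->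
  (x%:E <= expeR (- (n%:R%:E * rel_entropy a m)))%E.
Proof.
move=> m0 ma a1 x1 hx.
(* For [n = 0] the exponent is 0 even when the entropy is infinite, and [x <= 1] suffices; likewise
   when [m = a]. *)
case: n hx => [|n] hx; first by rewrite mul0e oppe0 expeR0.
have [ea|na] := eqVneq m a.
  by rewrite ea rel_entropy_refl ?mule0 ?oppe0 ?expeR0// -ea m0 ea.
have {na}ma : m < a by rewrite lt_neqAle na.
have n0 : 0 < n.+1%:R :> R by rewrite ltr0n.
move: m0; rewrite le_eqVlt => /predU1P[m0|m0].
  subst m; rewrite rel_entropy0r ?ma// gt0_muley ?lte_fin//= lee_fin leNgt.
  apply/negP => x0.
  (* Chosen so that the bound at [t] equals [expR (ln x - 1)], which is below [x]; [t] is
     nonnegative because [x <= 1]. *)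
  pose t := (1 - ln x) / (a * n.+1%:R).
  have t0 : 0 <= t.
    rewrite divr_ge0 ?mulr_ge0 ?ltW// subr_gt0.
    by rewrite (le_lt_trans _ ltr01)// ln_le0.
  have := hx t t0; rewrite mulr0 addr0 mulr1 -expRM_natr; apply/negP.
  rewrite -ltNge -[ltRHS]lnK ?posrE// ltr_expR.
  have -> : - (t * a) * n.+1%:R = ln x - 1.
    by rewrite mulNr -mulrA divfK ?opprB// gt_eqF ?mulr_gt0.
  by rewrite ltrBlDr ltrDl.
move: a1; rewrite le_eqVlt => /predU1P[a1|a1].
  subst a; rewrite rel_entropy1l// -EFinM mulrN -EFinN opprK /= lee_fin.
  rewrite mulrC expRM_natr lnK ?posrE//.
  (* The bound at [a = 1] and [t = k]; it tends to [m ^+ n.+1], the target. *)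
  pose u (k : nat) : R := (expR (- k%:R) * (1 - m) + m) ^+ n.+1.
  apply: (@cvgr_to_ge _ \oo _ _ u).
    have c : (expR (- k%:R) * (1 - m) + m) @[k --> \oo] --> m.
      rewrite -[X in _ --> X]add0r -[X in _ --> X + _](mul0r (1 - m)).
      apply: cvgD; last exact: cvg_cst.
      by apply: cvgM; [exact: cvgn_expR|exact: cvg_cst].
    exact: (cvg_comp _ _ c (@exprn_continuous R n.+1 m)).
  apply: nearW => k; rewrite /u; apply: (le_trans (hx k%:R _)) => //.
  rewrite mulr1 mulrDr mulr1 mulrBl mulrBr mul1r mulrA -expRD addNr expR0 mul1r.
  by rewrite le_eqVlt; apply/orP; left; apply/eqP; congr (_ ^+ _); ring.
have m1 : m < 1 by exact: lt_trans a1.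
have a0 : 0 < a by exact: lt_trans ma.
(* In the interior the critical [t] is admissible: [m < a] makes the ratio under the logarithm at
   least 1. *)
rewrite rel_entropy_interior// -EFinM -EFinN /= lee_fin -mulrN mulrC expRM_natr.
rewrite -expR_tilt//; apply: hx; rewrite ln_ge0// ler_pdivlMr ?mul1r.
  by rewrite mulrBr mulrBr !mulr1 [a * m]mulrC lerD2r ltW.
by rewrite mulr_gt0// subr_gt0.
Qed.

(** * Quadratic forms and measurability of positive semidefiniteness *)

Lemma symmetricmxE (R : fieldType) (d : nat) (M : 'M[R]_d) :
  (M \is symmetricmx) = (M^T == M).
Proof. by rewrite qualifE /= expr0 scale1r map_mx_id// eq_sym. Qed.

Lemma quad_mxE (R : realType) (d : nat) (M : 'M[R]_d) (v : 'cV[R]_d) :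
  (v^T *m M *m v) 0 0 = \sum_j (\sum_i v i 0 * M i j) * v j 0.
Proof.
rewrite mxE; apply: eq_bigr => j _; rewrite mxE; congr (_ * _).
by apply: eq_bigr => i _; rewrite mxE.
Qed.

(** The quadratic form at the [i]-th basis vector is the [i]-th diagonal entry. *)
Lemma psdmx_diag_ge0 (R : realType) (d : nat) (M : 'M[R]_d) (i : 'I_d) :
  psdmx M -> 0 <= M i i.
Proof.
move=> [_ /(_ (delta_mx i 0))]; rewrite quad_mxE.
rewrite (bigD1 i)//= [X in _ + X]big1 ?addr0; last first.
  by move=> j ji; rewrite [delta_mx _ _ j _]mxE (negbTE ji) mulr0.
rewrite (bigD1 i)//= [X in _ + X]big1 ?addr0; last first.
  by move=> j ji; rewrite mxE (negbTE ji) mul0r.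
by rewrite !mxE !eqxx mul1r mulr1.
Qed.

Lemma quad_mx_continuous (R : realType) (d : nat) (M : 'M[R]_d) :
  continuous (fun v : 'cV[R]_d => (v^T *m M *m v) 0 0).
Proof.
have -> : (fun v : 'cV[R]_d => (v^T *m M *m v) 0 0) =
    (fun v => \sum_j (\sum_i v i 0 * M i j) * v j 0).
  by apply/funext => v; exact: quad_mxE.
have cc i : continuous (fun v : 'cV[R]_d => v i 0) by exact: coord_continuous.
apply: continuous_big => [|j _]; first exact: add_continuous.
move=> v; apply: continuousM; last exact: cc.
apply: continuous_big v => [|i _]; first exact: add_continuous.
by move=> v; apply: continuousM; [exact: cc|exact: cst_continuous].
Qed.

(** A neighbourhood of a vector contains a product of neighbourhoods of its coordinates, and each of
    these contains a rational. *)
Lemma dense_rat_cV (R : realType) (d : nat) :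
  dense (range (map_mx ratr : 'cV[rat]_d -> 'cV[R]_d)).
Proof.
move=> O [v Ov] oO.
have [Q nQ QO] : nbhs v O by exact: open_nbhs_nbhs.
have q_ i : exists q : rat, Q i 0 (ratr q).
  have : nbhs (v i 0) (Q i 0) by exact: nQ.
  rewrite nbhsE => -[B [oB Bv] BQ].
  have [x [Bx [q _ qx]]] := dense_rat (ex_intro _ _ Bv) oB.
  by exists q; rewrite qx; exact: BQ.
pose u : 'cV[rat]_d := \col_i projT1 (cid (q_ i)).
exists (map_mx ratr u); split; last by exists u.
by apply: QO => i j; rewrite ord1 !mxE; case: cid.
Qed.

(** The vectors where the form is negative make up an open set; if nonempty, it would contain a
    rational vector. *)
Lemma psdmx_rat (R : realType) (d : nat) (M : 'M[R]_d) :
  M \is symmetricmx ->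
  (forall u : 'cV[rat]_d,
     0 <= ((map_mx ratr u)^T *m M *m map_mx ratr u) 0 0 :> R) -> psdmx M.
Proof.
move=> Msym Mu; split=> // v; rewrite leNgt; apply/negP => v0.
have [|v' [v'0 [u _ uv']]] := @dense_rat_cV R d
    ((fun v => (v^T *m M *m v) 0 0) @^-1` [set x | x < 0]) (ex_intro _ v v0).
  by apply: open_comp => // x _; exact: quad_mx_continuous.
by move: v'0; rewrite -uv' /= ltNge Mu.
Qed.

(* Rational test vectors make this a countable intersection. *)
Lemma measurable_psdmx (R : realType) (disp : measure_display)
    (T : measurableType disp) (d : nat) (M : T -> 'M[R]_d) :
  (forall w, M w \is symmetricmx) ->
  (forall i j, measurable_fun setT (fun w => M w i j)) ->
  measurable [set w | psdmx (M w)].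
Proof.
move=> Msym mM.
(* [unpickle] enumerates the rational vectors; a code that decodes to none tests the zero vector,
   where the form vanishes. *)
have -> : [set w | psdmx (M w)] = \bigcap_n [set w |
    let v : 'cV[R]_d :=
      map_mx ratr (odflt 0 (unpickle n : option 'cV[rat]_d)) in
    0 <= (v^T *m M w *m v) 0 0].
  apply/seteqP; split => w /=; first by move=> [_ Mw] n _; exact: Mw.
  move=> Mw; apply: psdmx_rat => // u.
  by have := Mw (pickle u) I; rewrite /= pickleK.
apply: bigcapT_measurable => n /=.
rewrite -[X in measurable X]setTI; apply: measurable_fun_le => //.
under eq_fun do rewrite quad_mxE.
apply: measurable_sum => j; apply: measurable_funM => //.
by apply: measurable_sum => i; apply: measurable_funM.
Qed.

(** * Reduction of the matrix event to top-left entries *)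

Theorem corollary2p6 (R : realType) (disp : measure_display)
    (T : measurableType disp) (P : probability T R)
    (d n : nat) (hd : (0 < d)%N)
    (X : {RV P >-> borel_mx R d}) (Xs : 'I_n -> {RV P >-> borel_mx R d})
    (X_sym : forall w : T, (X w : 'M[R]_d) \is symmetricmx)
    (Xs_sym : forall (i : 'I_n) (w : T), (Xs i w : 'M[R]_d) \is symmetricmx)
    (X_iid : iid (fun o : option 'I_n => oapp Xs X o))
    (X_bnd : {ae P, forall w, loewner (0 : 'M[R]_d) (X w) /\
                              loewner (X w) (1%:M : 'M[R]_d)})
    (m a : R) (h0m : 0 <= m) (hma : m <= a) (ha1 : a <= 1)
    (EX : loewner (expectation_mx P (X : T -> 'M[R]_d)) (m%:M))
    (A : 'M[R]_d) (A_sym : A \is symmetricmx)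
    (hA : loewner (a%:M) A) :
  (P [set w | loewner (n%:R *: A) (\sum_(i < n) (Xs i w : 'M[R]_d))] <=
   expeR (- (n%:R%:E * rel_entropy a m)))%E.
Proof.
pose i0 : 'I_d := Ordinal hd.
pose entry i j : borel_mx R d -> R := fun M => (M : 'M[R]_d) i j.
have mentry i j : measurable_fun setT (entry i j).
  by apply: continuous_measurable_mx; exact: coord_continuous.
have mXs k i j : measurable_fun setT (entry i j \o Xs k).
  exact: measurableT_comp.
pose Y := entry i0 i0 \o X; pose Ys k := entry i0 i0 \o Xs k.
have mY : measurable_fun setT Y by exact: measurableT_comp.
have mYs k : measurable_fun setT (Ys k) by exact: mXs.
have Y01 : {ae P, forall w, 0 <= Y w <= 1}.
  apply: filterS X_bnd => w [/(psdmx_diag_ge0 i0) X0 /(psdmx_diag_ge0 i0) X1].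
  by move: X0 X1; rewrite !mxE eqxx subr0 subr_ge0 => X0 X1; apply/andP.
have EY : (\int[P]_w `|Y w|%:E <= m%:E)%E.
  have mnY : measurable_fun setT (fun w => `|Y w|%:E).
    by apply/measurable_EFinP; exact: measurableT_comp.
  (* Integrability ensures that [fine] in [expectation_mx] returns the true mean instead of the
     default for an infinite value. *)
  have EY1 : (\int[P]_w `|Y w|%:E <= 1%:E)%E.
    have <- : (\int[P]_w (cst 1%:E w) = 1%:E :> \bar R)%E.
      rewrite integral_cst// mul1e; exact: probability_setT.
    apply: ae_ge0_le_integral => //; apply: filterS Y01 => w /andP[Y0 Y1] _.
    by rewrite lee_fin ger0_norm.
  have EYfin : (\int[P]_w `|Y w|%:E)%E \is a fin_num.
    by rewrite ge0_fin_numE ?(le_lt_trans EY1) ?ltry ?integral_ge0.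
  have EYE : (\int[P]_w `|Y w|%:E = \int[P]_w (Y w)%:E)%E.
    apply: ae_eq_integral => //; first exact/measurable_EFinP.
    by apply: filterS Y01 => w /andP[Y0 _] _; rewrite ger0_norm.
  rewrite {EY1}EYE in EYfin *.
  have := psdmx_diag_ge0 i0 EX; rewrite !mxE eqxx subr_ge0 unlock.
  by move=> h; rewrite -(fineK EYfin) lee_fin.
have iidY (B : 'I_n -> set R) : (forall i, measurable (B i)) ->
    P (\bigcap_(i in setT) (Ys i @^-1` B i)) =
    (\prod_(i < n) P (Y @^-1` B i))%E.
  move=> mB; have [indep ident] := X_iid.
  (* Independence is applied to the indices [Some i]; equality of laws with the index [None], which
     carries [X], then replaces each [Xs i] by [X]. *)
  pose C (o : option 'I_n) := oapp (fun i => entry i0 i0 @^-1` B i) setT o.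
  have mC o : measurable (C o).
    case: o => [i|]//=; rewrite -[X in measurable X]setTI; exact: mentry.
  have := indep [set Some i | i : 'I_n] C mC.
  rewrite big_imset/=; last by move=> i j _ _ [].
  have -> : \bigcap_(o in [set` [set Some i | i : 'I_n]])
      ((oapp Xs X o : T -> _) @^-1` C o) = \bigcap_(i in setT) (Ys i @^-1` B i).
    apply/seteqP; split => w /= h.
      by move=> i _; apply: (h (Some i)); rewrite /= imset_f.
    by move=> _ /imsetP[i _ ->]; exact: h.
  move=> ->; apply: eq_bigr => i _.
  exact: (ident (Some i) None _ (mC (Some i))).
have mE : measurable [set w | n%:R * a <= \sum_(i < n) Ys i w].
  rewrite -[X in measurable X]setTI.
  by apply: measurable_fun_le => //; exact: measurable_sum.
have PA t : 0 <= t -> _ := chernoff_mgf a mY mYs iidY Y01 EY.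
apply: (@le_trans _ _ (P [set w | (n%:R * a <= \sum_(i < n) Ys i w)%R])).
  (* Monotonicity of [P] requires both events to be measurable, hence the appeal to
     [measurable_psdmx]. *)
  apply: le_measure; rewrite ?inE//.
    apply: measurable_psdmx => [w|i j].
      rewrite symmetricmxE linearB/= linearZ/= raddf_sum/=.
      move: A_sym; rewrite symmetricmxE => /eqP ->.
      apply/eqP; congr (_ - _); apply: eq_bigr => k _.
      by apply/eqP; rewrite -symmetricmxE.
    apply: (@eq_measurable_fun _ _ _ _ _
      (fun w => \sum_(k < n) entry i j (Xs k w) - n%:R * A i j)).
      by move=> w _; rewrite !mxE summxE.
    by apply: measurable_funB => //; apply: measurable_sum => k; exact: mXs.
  move=> w /= /(psdmx_diag_ge0 i0); have := psdmx_diag_ge0 i0 hA.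
  rewrite !mxE summxE eqxx !subr_ge0 => aA; apply: le_trans.
  by rewrite ler_wpM2l.
rewrite -[leLHS]fineK ?fin_num_measure//.
apply: le_expeR_rel_entropy => //.
  by rewrite -lee_fin fineK ?fin_num_measure// probability_le1.
by move=> t t0; rewrite -lee_fin fineK ?fin_num_measure// PA.
Qed.
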